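(* Let $d\ge1$, let $\kappa:[-1,1]\to\mathbb{R}$ be given by $\kappa(t)=\sum_{q\ge 0}\frac{J_q^2}{q!}t^q$ with $J_q\in\mathbb{R}$, $J_q\neq0$ for infinitely many $q$, $\sum_{q\ge1}\frac{|J_q|}{(q-1)!}<\infty$, and $\kappa(1)=1$; let $\kappa_L$ denote the $L$-fold composition of $\kappa$. For each $L\ge1$ let $(T_L(x))_{x\in\mathbb{S}^d}$ be a continuous, isotropic, centered Gaussian random field on $\mathbb{S}^d$ with $\mathrm{Cov}(T_L(x),T_L(y))=\kappa_L(\langle x,y\rangle)$. Let $N$ be the North Pole of $\mathbb{S}^d$, let $m\ge1$, let $x_1,\dots,x_m\in\mathbb{S}^d$ be pairwise distinct, $\underline{x}=(x_1,\dots,x_m)$, $T_L(\underline{x})=(T_L(x_1),\dots,T_L(x_m))$, and $\boldsymbol{1}=(1,\dots,1)\in\mathbb{R}^m$. Assume $\kappa'(1)\le1$, and if $\kappa'(1)=1$ assume moreover that there exist $c\in\mathbb{R}\setminus\{0\}$ and $\rho>1$ with $1-\kappa(t)=\kappa'(1)(1-t)-c(1-t)^{\rho}+o((1-t)^{\rho})$ as $t\to1^-$. Define $v_L$ and $\mathfrak{g}:[-1,1]\to\mathbb{R}$ by: \begin{itemize} \item if $\kappa'(1)<1$: $v_L=(\kappa'(1))^{-L}$ and $\mathfrak{g}(t)=\mathfrak{L}(t):=\lim_{L\to\infty}(\kappa'(1))^{-L}(1-\kappa_L(t))$; \item if $\kappa'(1)=1$: $v_L=L^{1/(\rho-1)}$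 and $\mathfrak{g}(t)=\mathfrak{S}(t):=\lim_{L\to\infty}L^{1/(\rho-1)}(1-\kappa_L(t))$ \end{itemize} (these limits exist). Then the sequence $\{T_L(\underline{x})-T_L(N)\boldsymbol{1}\}_{L\ge1}$ of $\mathbb{R}^m$-valued random vectors satisfies a large deviation principle with speed $v_L$ and good rate function \[ I_{1;\mathfrak{g}}(\underline{y};\underline{x})=\sup_{\underline{\theta}\in\mathbb{R}^m}\Bigl\{\langle\underline{\theta},\underline{y}\rangle-\tfrac12\langle\underline{\theta},B_{1;\mathfrak{g}}(\underline{x})\underline{\theta}\rangle\Bigr\},\qquad \underline{y}\in\mathbb{R}^m, \] where $B_{1;\mathfrak{g}}(\underline{x})$ is the $m\times m$ matrix with entries $\mathfrak{g}(\langle x_i,N\rangle)+\mathfrak{g}(\langle x_j,N\rangle)-\mathfrak{g}(\langle x_i,x_j\rangle)$, $i,j=1,\dots,m$.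
   Context: A sequence $\{X_L\}$ of random vectors in $\mathbb{R}^m$ satisfies a large deviation principle (LDP) with speed $v_L\to\infty$ and rate function $I$ (lower semicontinuous, $[0,\infty]$-valued; good if its level sets are compact) if $\limsup_L v_L^{-1}\log P(X_L\in C)\le-\inf_C I$ for all closed $C$ and $\liminf_L v_L^{-1}\log P(X_L\in O)\ge-\inf_O I$ for all open $O$. *)

(* Defs.v *)
From HB Require Import structures.
From mathcomp Require Import all_boot all_order all_algebra.
From mathcomp Require Import all_classical all_reals all_analysis.
Set Implicit Arguments. Unset Strict Implicit. Unset Printing Implicit Defensive.
Import Order.TTheory GRing.Theory Num.Theory.
Import numFieldNormedType.Exports.
Local Open Scope classical_set_scope.
Local Open Scope ring_scope.

Section Defs.
Variable R : realType.

Definition dotv (n : nat) (x y : 'rV[R]_n) : R := (x *m y^T) 0 0.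

Definition sphere (d : nat) (x : 'rV[R]_d.+1) : Prop := dotv x x = 1.

Definition north_pole (d : nat) : 'rV[R]_d.+1 := \row_i (i == ord_max)%:R.

Definition kappa (J : nat -> R) (t : R) : R :=
  limn (series (fun q : nat => J q ^+ 2 / (q`!)%:R * t ^+ q)).

Definition kappa_iter (J : nat -> R) (L : nat) : R -> R := iter L (kappa J).

Definition centered_normal_rv dT (T : measurableType dT) (P : probability T R)
    (X : T -> R) (v : R) : Prop :=
  measurable_fun setT X /\
  forall A : set R, measurable A ->
    P (X @^-1` A) = (if v == 0 then \d_(0:R) A else normal_prob 0 (Num.sqrt v) A).

Definition centered_gaussian_field (d : nat) dT (T : measurableType dT)
    (P : probability T R) (X : 'rV[R]_d.+1 -> T -> R)
    (K : 'rV[R]_d.+1 -> 'rV[R]_d.+1 -> R) : Prop :=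
  forall (n : nat) (xs : 'I_n -> 'rV[R]_d.+1) (th : 'I_n -> R),
    (forall i, sphere (xs i)) ->
    centered_normal_rv P (fun w => \sum_(i < n) th i * X (xs i) w)
      (\sum_(i < n) \sum_(j < n) th i * th j * K (xs i) (xs j)).

Definition as_continuous_field (d : nat) dT (T : measurableType dT)
    (P : probability T R) (X : 'rV[R]_d.+1 -> T -> R) : Prop :=
  {ae P, forall w, {within @sphere d, continuous (fun x => X x w)}}.

Definition elog (x : \bar R) : \bar R :=
  match x with
  | r%:E => if (0 < r)%R then (ln r)%:E else -oo
  | _ => +oo
  end%E.

Definition good_rate_function (m : nat) (I : 'rV[R]_m -> \bar R) : Prop :=
  (forall y, 0 <= I y)%E /\ lower_semicontinuous I /\
  forall a : R, compact [set y | (I y <= a%:E)%E].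

Definition LDP (m : nat) (dO : nat -> measure_display)
    (Om : forall L, measurableType (dO L)) (P : forall L, probability (Om L) R)
    (X : forall L, Om L -> 'rV[R]_m) (v : nat -> R) (I : 'rV[R]_m -> \bar R)
    : Prop :=
  (forall C : set 'rV[R]_m, closed C ->
     (limn_esup (fun L => ((v L)^-1)%:E * elog (P L (X L @^-1` C)))
       <= - ereal_inf (I @` C))%E) /\
  (forall O : set 'rV[R]_m, open O ->
     (- ereal_inf (I @` O)
       <= limn_einf (fun L => ((v L)^-1)%:E * elog (P L (X L @^-1` O))))%E).

Definition Bmat (d m : nat) (g : R -> R) (xs : 'I_m -> 'rV[R]_d.+1) : 'M[R]_m :=
  \matrix_(i, j) (g (dotv (xs i) (north_pole d)) + g (dotv (xs j) (north_pole d))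
                  - g (dotv (xs i) (xs j))).

Definition rate_I (d m : nat) (g : R -> R) (xs : 'I_m -> 'rV[R]_d.+1)
    (y : 'rV[R]_m) : \bar R :=
  ereal_sup (range (fun th : 'rV[R]_m =>
    (dotv th y - 2^-1 * (th *m Bmat g xs *m th^T) 0 0)%:E)).

End Defs.

Arguments north_pole {R} d.

(* Main.v *)
Require Import Defs.
From HB Require Import structures.
From mathcomp Require Import all_boot all_order all_algebra.
From mathcomp Require Import all_classical all_reals all_analysis.
From mathcomp Require Import measurable_realfun ring lra.
Set Implicit Arguments. Unset Strict Implicit. Unset Printing Implicit Defensive.
Import Order.TTheory GRing.Theory Num.Theory.
Import numFieldNormedType.Exports.
Local Open Scope classical_set_scope.
Local Open Scope ring_scope.

(** Since [kappa] is a convex combination of monomials, its chord slope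
[(1 - kappa t) / (1 - t)] on [[-1, 1)] is at most its limit [k1] at [1].  Hence
for [k1 < 1] the sequence [k1 ^- L * (1 - kappa_L t)] is nonincreasing, and it
converges.  For [k1 = 1] the slope is strictly below [1] away from [1], so
[u_L = 1 - kappa_L t] tends to [0]; the expansion of [kappa] makes the increments
of [u_L `^ (1 - rho)] converge to [(rho - 1) * c], and Cesaro's theorem gives
[u_L ~ ((rho - 1) * c * L) `^ (- (rho - 1)^-1)].

The increments [T_L x_i - T_L N] are Gaussian with covariance [Sigma_L] such that
[v_L Sigma_L --> B], so the scaled log-moment generating functions converge to
[theta B theta^T / 2].  The hypothesis only describes the laws of linear
combinations, but both LDP bounds need nothing else: the upper bound covers a
closed set by finitely many half-spaces (Chernoff) and the complement of a box;
for the lower bound at [y = theta B] the density [exp (v_L <theta, X_L>)] is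
used, under which the complement of a small box around [y] is exponentially
negligible, again by Chernoff's bound on half-spaces.  If [y] is not in the range
of [B], a kernel vector of [B] not orthogonal to [y] shows that the rate is
infinite, so there is nothing to prove. *)

(** * Iterates of the covariance kernel *)

Lemma cvg_within_near {T : Type} {U : topologicalType} (F : set_system T)
    {FF : Filter F} (u : T -> U) (l : U) (D : set U) :
  u @ F --> l -> (\forall n \near F, D (u n)) -> u @ F --> within D (nbhs l).
Proof.
move=> ul uD P hP; have := ul _ hP.
by apply: filterS2 uD => n Dn; apply.
Qed.

Lemma cvg_powR_at {R : realType} (p l : R) {T : Type} (F : set_system T)
    {FF : Filter F} (u : T -> R) :
  0 < l -> u @ F --> l -> (fun n => u n `^ p) @ F --> l `^ p.
Proof.
move=> l0 ul; apply: (@cvg_comp _ _ _ u (@powR R ^~ p) F (nbhs l) _ ul).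
have : derivable (@powR R ^~ p) l 1 by apply: derivable_powR; rewrite in_itv/= l0.
by move=> /derivable1_diffP/differentiable_continuous.
Qed.

(* The substitution [z = u `^ (- alpha)] turns the recursion into one whose
   increments converge, so that Cesaro summation applies. *)
Lemma cvg_power_decay {R : realType} (u : nat -> R) (alpha c : R) :
  0 < alpha -> 0 < c -> (forall n, 0 < u n) -> u @ \oo --> (0 : R) ->
  (fun n => (u n - u n.+1) / u n `^ (alpha + 1)) @ \oo --> c ->
  (fun n => (n%:R : R) `^ alpha^-1 * u n) @ \oo
    --> (alpha * c) `^ (- alpha^-1).
Proof.
move=> a0 c0 u0 ucv uc.
have ua : (fun n => u n `^ alpha) @ \oo --> (0 : R).
  apply: (@cvg_comp _ _ _ u (@powR R ^~ alpha) _ (0^'+) _ _ (powR_cvg0 a0)).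
  by apply: cvg_within_near => //; exact: nearW.
pose h n := u n.+1 / u n - 1.
have hua : (fun n => h n / u n `^ alpha) @ \oo --> - c.
  rewrite (_ : (fun n => _) = (fun n => - ((u n - u n.+1) / u n `^ (alpha + 1)))).
    exact: cvgN.
  apply/funext => n; rewrite powRD; last by rewrite gt_eqF ?addr_gt0.
  rewrite powRr1 ?ltW// /h; field.
  by rewrite !gt_eqF// powR_gt0.
have h0 : h @ \oo --> (0 : R).
  rewrite -(mulr0 (- c)).
  rewrite (_ : h = (fun n => (h n / u n `^ alpha) * u n `^ alpha)).
    exact: cvgM.
  by apply/funext => n; rewrite divfK// gt_eqF// powR_gt0.
have hn0 : \forall n \near \oo, h n != 0.
  have : \forall n \near \oo, h n / u n `^ alpha < 0.
    by apply: (cvgr_lt _ hua); rewrite oppr_lt0.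
  apply: filterS => n; apply: contraTneq => ->; by rewrite mul0r ltxx.
pose f := @powR R ^~ (- alpha).
have fd : (fun n => (h n)^-1 * (f (h n + 1) - f 1)) @ \oo --> - alpha.
  have d1 : is_derive (1 : R) 1 f (- alpha * 1 `^ (- alpha - 1)).
    exact: is_derive1_powR.
  have [dv dE] := d1.
  have := dE; rewrite powR1 mulr1 => <-.
  have h0' : h @ \oo --> (0 : R)^' by apply: cvg_within_near.
  apply: (@cvg_comp _ _ _ h (fun x => x^-1 * (f (x + 1) - f 1)) _ _ _ h0').
  rewrite /derive.
  rewrite /derivable in dv.
  rewrite (_ : (fun h => h^-1 * (f (h + 1) - f 1)) =
     (fun h => h^-1 *: ((f \o shift 1) (h *: (1 : R)) - f 1))).
    exact: dv.
  by apply/funext => x /=; rewrite /shift/= [x *: 1]mulr1.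
pose z n := u n `^ (- alpha).
have zE n : z n.+1 - z n = z n * (f (h n + 1) - f 1).
  rewrite /z /f powR1 mulrBr mulr1 -powRM ?ltW//; last first.
    by rewrite /h subrK divr_gt0.
  by rewrite /h subrK mulrC divfK// gt_eqF.
have dz : (fun n => z n.+1 - z n) @ \oo --> alpha * c.
  rewrite -mulrNN; apply: cvg_trans (cvgM fd hua).
  apply: near_eq_cvg; apply: filterS hn0 => n hn.
  rewrite /= zE /z powRN; field.
  by rewrite hn gt_eqF// powR_gt0.
have zn : (fun n => z n / n%:R) @ \oo --> alpha * c.
  (* After the shift the denominator is [n.+1], as in [arithmetic_mean]; telescoping leaves the
     extra term [z 0 / n.+1]. *)
  rewrite -cvg_shiftS/= -(addr0 (alpha * c)).
  rewrite (_ : (fun n => _) = (fun n => arithmetic_mean (fun n => z n.+1 - z n) n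
     + z 0%N * n.+1%:R^-1)).
    apply: cvgD; first exact: cesaro.
    by rewrite -(mulr0 (z 0%N)); apply: cvgMr; exact: cvg_harmonic.
  apply/funext => n; rewrite /arithmetic_mean/= /series/= telescope_sumr//.
  by rewrite [n.+1%:R^-1 * _]mulrC -mulrDl subrK.
have ac : 0 < alpha * c by rewrite mulr_gt0.
apply: cvg_trans (@cvg_powR_at _ (- alpha^-1) _ _ _ _ _ ac zn).
apply: near_eq_cvg; exists 1%N => // n /= n1.
rewrite powRM ?invr_ge0// ?powR_ge0//.
rewrite /z -powRrM mulrNN divff ?gt_eqF// powRr1 ?ltW//.
by rewrite -[n%:R^-1]powR_inv1// -powRrM mulrNN mul1r mulrC.
Qed.

Section Kappa.
Variables (R : realType) (J : nat -> R).
Hypothesis hJ : series (fun q : nat => J q ^+ 2 / (q`!)%:R) @ \oo --> (1 : R).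

Let a q := J q ^+ 2 / (q`!)%:R.

Let a_ge0 q : 0 <= a q.
Proof. by rewrite /a divr_ge0// sqr_ge0. Qed.

(** Domination by the summable coefficients makes the [limn] in [kappa] a genuine sum. *)
Lemma kappa_cvg t : `|t| <= 1 ->
  series (fun q => J q ^+ 2 / (q`!)%:R * t ^+ q) @ \oo --> kappa J t.
Proof.
move=> t1.
suff : cvgn (series (fun q => a q * t ^+ q)) by [].
apply: normed_cvg.
apply: (@series_le_cvg _ _ a) => //.
- by move=> q /=.
- move=> q /=; rewrite normrM normrX (ger0_norm (a_ge0 q)).
  by rewrite ler_piMr// exprn_ile1.
- by apply/cvg_ex; exists 1.
Qed.

Lemma kappa1 : kappa J 1 = 1.
Proof.
rewrite /kappa; under eq_fun do rewrite expr1n mulr1.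
exact: (cvg_lim _ hJ).
Qed.

(** The coefficients are nonnegative with sum [1], so an affine inequality valid for all pairs of
    powers passes to [kappa]. Keeping the term [q0] on the left is what later yields strict
    inequalities. *)
Lemma kappa_lin_ge (x y z t s : R) (q0 : nat) : `|t| <= 1 -> `|s| <= 1 ->
  (forall q, 0 <= x + y * t ^+ q + z * s ^+ q) ->
  J q0 ^+ 2 / (q0`!)%:R * (x + y * t ^+ q0 + z * s ^+ q0)
    <= x + y * kappa J t + z * kappa J s.
Proof.
move=> t1 s1 h.
pose b q := a q * (x + y * t ^+ q + z * s ^+ q).
have b0 q : 0 <= b q by rewrite mulr_ge0.
have cb : series b @ \oo --> x + y * kappa J t + z * kappa J s.
  have -> : series b = (fun n => x * series a n
     + y * series (fun q => a q * t ^+ q) n + z * series (fun q => a q * s ^+ q) n).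
    apply/funext => n; rewrite /series/= !mulr_sumr -!big_split/=.
    by apply: eq_bigr => i _; rewrite /b; ring.
  apply: cvgD; [apply: cvgD|].
  - by rewrite -[X in _ --> X]mulr1; apply: cvgMr; exact: hJ.
  - by apply: cvgMr; exact: kappa_cvg.
  - by apply: cvgMr; exact: kappa_cvg.
apply: (cvgr_to_ge cb).
exists q0.+1 => // n /= qn.
rewrite /series/= (bigD1_seq q0)//= ?iota_uniq//; last by rewrite mem_index_iota.
by rewrite -/(b q0) lerDl sumr_ge0.
Qed.

Lemma kappa_lin_ge0 (x y z t s : R) : `|t| <= 1 -> `|s| <= 1 ->
  (forall q, 0 <= x + y * t ^+ q + z * s ^+ q) ->
  0 <= x + y * kappa J t + z * kappa J s.
Proof.
move=> t1 s1 h; apply: le_trans (kappa_lin_ge 0 t1 s1 h).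
by rewrite mulr_ge0 ?a_ge0.
Qed.

Lemma kappa_norm_le1 t : `|t| <= 1 -> `|kappa J t| <= 1.
Proof.
move=> t1; have tq q : `|t ^+ q| <= 1 by rewrite normrX exprn_ile1.
rewrite ler_norml; apply/andP; split.
  have := @kappa_lin_ge0 1 1 0 t t t1 t1; rewrite mul0r addr0 mul1r => h.
  rewrite -subr_ge0 opprK addrC; apply: h => q.
  by have := tq q; rewrite ler_norml => /andP[]; lra.
have := @kappa_lin_ge0 1 (-1) 0 t t t1 t1; rewrite mul0r addr0 mulN1r => h.
rewrite -subr_ge0; apply: h => q.
by have := tq q; rewrite ler_norml => /andP[]; lra.
Qed.

Lemma kappa_iter_norm_le1 L t : `|t| <= 1 -> `|kappa_iter J L t| <= 1.
Proof. by move=> t1; elim: L => //= L ih; exact: kappa_norm_le1. Qed.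

Lemma kappa_iter1 L : kappa_iter J L 1 = 1.
Proof. by elim: L => //= L; rewrite /kappa_iter/= => ->; exact: kappa1. Qed.

(** Cross-multiplied form of [(1 - t^q) / (1 - t) <= (1 - s^q) / (1 - s)]. The sign of [s] matters:
    for [q = 3] the slope [1 + t + t^2] decreases on [[-1, -1/2]]. For [t < 0] each power is
    compared with its base; for [0 <= t] induction on [q] adds a nonnegative increment. *)
Lemma chord_pow_ge0 (t s : R) q : -1 <= t -> t <= s -> 0 <= s -> s <= 1 ->
  0 <= (s - t) + (1 - s) * t ^+ q + (- (1 - t)) * s ^+ q.
Proof.
move=> t1 ts s0 s1.
have [t0|t0] := leP 0 t; last first.
  case: q => [|q]; first by rewrite !expr0; lra.
  have sq : s ^+ q.+1 <= s by rewrite exprS ler_piMr// exprn_ile1.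
  have tq : t <= t ^+ q.+1.
    have : `|t ^+ q.+1| <= `|t|.
      by rewrite normrX exprS ler_piMr// exprn_ile1// ler_norml; apply/andP; lra.
    by rewrite (ltr0_norm t0) ler_norml opprK => /andP[].
  have h1 : 0 <= (1 - s) * (t ^+ q.+1 - t) by rewrite mulr_ge0 ?subr_ge0//.
  have h2 : 0 <= (1 - t) * (s - s ^+ q.+1) by rewrite mulr_ge0 ?subr_ge0//; lra.
  by nra.
elim: q => [|q ih]; first by rewrite !expr0; lra.
have e : s - t + (1 - s) * t ^+ q.+1 + - (1 - t) * s ^+ q.+1 =
  (s - t + (1 - s) * t ^+ q + - (1 - t) * s ^+ q)
  + (1 - s) * (1 - t) * (s ^+ q - t ^+ q) by rewrite !exprS; ring.
rewrite e addr_ge0// mulr_ge0//; first by rewrite mulr_ge0; lra.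
by rewrite subr_ge0 lerXn2r// nnegrE.
Qed.

Lemma chord_pow_gt0 (t s : R) q : 0 <= t -> t < s -> s < 1 -> (2 <= q)%N ->
  0 < (s - t) + (1 - s) * t ^+ q + (- (1 - t)) * s ^+ q.
Proof.
move=> t0 ts s1; case: q => [//|[//|q]] _.
have e : s - t + (1 - s) * t ^+ q.+2 + - (1 - t) * s ^+ q.+2 =
  (s - t + (1 - s) * t ^+ q.+1 + - (1 - t) * s ^+ q.+1)
  + (1 - s) * (1 - t) * (s ^+ q.+1 - t ^+ q.+1) by rewrite !exprS; ring.
rewrite e ltr_wpDl//; first by apply: chord_pow_ge0; lra.
rewrite mulr_gt0//; first by rewrite mulr_gt0; lra.
by rewrite subr_gt0 ltrXn2r//; lra.
Qed.

Lemma kappa_chord_le (t s : R) : -1 <= t -> t <= s -> 0 <= s -> s < 1 ->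
  (1 - kappa J t) / (1 - t) <= (1 - kappa J s) / (1 - s).
Proof.
move=> t1 ts s0 s1.
rewrite ler_pdivrMr ?subr_gt0; last lra.
rewrite mulrAC ler_pdivlMr ?subr_gt0// -subr_ge0.
have := @kappa_lin_ge0 (s - t) (1 - s) (- (1 - t)) t s.
have T : `|t| <= 1 by rewrite ler_norml; apply/andP; lra.
have S : `|s| <= 1 by rewrite ler_norml; apply/andP; lra.
move=> /(_ T S) h.
have : 0 <= s - t + (1 - s) * kappa J t + - (1 - t) * kappa J s.
  by apply: h => q; apply: chord_pow_ge0; lra.
by lra.
Qed.

Hypothesis hJinf : forall n : nat, exists q : nat, (n <= q)%N /\ J q != 0.

Lemma kappa_chord_lt (t s : R) : 0 <= t -> t < s -> s < 1 ->
  (1 - kappa J t) / (1 - t) < (1 - kappa J s) / (1 - s).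
Proof.
move=> t0 ts s1.
rewrite ltr_pdivrMr ?subr_gt0; last lra.
rewrite mulrAC ltr_pdivlMr ?subr_gt0// -subr_gt0.
(* Monomials of degree at least [2] have strictly increasing slopes on [[0, 1)]; one of them occurs
   in [kappa]. *)
have [q0 [q2 Jq]] := hJinf 2.
have T : `|t| <= 1 by rewrite ler_norml; apply/andP; lra.
have S : `|s| <= 1 by rewrite ler_norml; apply/andP; lra.
have := @kappa_lin_ge (s - t) (1 - s) (- (1 - t)) t s q0 T S.
move=> h.
have : 0 < s - t + (1 - s) * kappa J t + - (1 - t) * kappa J s.
  apply: lt_le_trans (h _); last by move=> q; apply: chord_pow_ge0; lra.
  rewrite mulr_gt0 ?chord_pow_gt0//.
  by rewrite divr_gt0// ?exprn_even_gt0//= ltr0n fact_gt0.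
by lra.
Qed.

Variable k1 : R.
Hypothesis hk1 : (fun t => (kappa J 1 - kappa J t) / (1 - t)) @ 1^'- --> k1.

Lemma chord_le_k1 (t : R) : -1 <= t -> t < 1 ->
  (1 - kappa J t) / (1 - t) <= k1.
Proof.
move=> tN t1.
apply: (cvgr_to_ge hk1).
near=> s; rewrite kappa1; apply: kappa_chord_le => //; near: s.
- exact: nbhs_left_ge.
- exact: nbhs_left_ge.
Unshelve. all: by end_near. Qed.

Lemma kappa_contract (t : R) : `|t| <= 1 -> 1 - kappa J t <= k1 * (1 - t).
Proof.
rewrite ler_norml => /andP[t1]; rewrite le_eqVlt => /orP[/eqP ->|t2].
  by rewrite kappa1; lra.
by rewrite -ler_pdivrMr ?subr_gt0//; exact: chord_le_k1.
Qed.

Lemma chord_lt_k1 (t : R) : -1 <= t -> t < 1 ->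
  (1 - kappa J t) / (1 - t) < k1.
Proof.
move=> tN t1.
(* Truncation at [0] enters the range where slopes increase strictly; the midpoint of [s] and [1]
   then leaves a gap below [k1]. *)
pose s := Num.max t 0.
have s1 : s < 1 by rewrite /s gt_max t1/=.
have s0 : 0 <= s by rewrite /s le_max lexx orbT.
apply: (@le_lt_trans _ _ ((1 - kappa J s) / (1 - s))).
  by apply: kappa_chord_le => //; rewrite /s le_max lexx.
apply: (@lt_le_trans _ _ ((1 - kappa J ((s + 1) / 2)) / (1 - (s + 1) / 2))).
  by apply: kappa_chord_lt => //; lra.
by apply: chord_le_k1; lra.
Qed.

Lemma k1_gt0 : 0 < k1.
Proof.
apply: le_lt_trans (@chord_lt_k1 0 _ _) => //.
  rewrite subr0 divr1 subr_ge0.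
  by have := @kappa_norm_le1 0; rewrite normr0 => /(_ ler01); rewrite ler_norml => /andP[].
Qed.

Lemma cvg_geometric_speed (t : R) : `|t| <= 1 ->
  cvgn (fun L : nat => k1 ^- L * (1 - kappa_iter J L t)).
Proof.
move=> t1.
apply: nonincreasing_is_cvgn.
  apply/nonincreasing_seqP => L.
  rewrite exprS invfM -mulrA mulrCA.
  rewrite ler_wpM2l// ?invr_ge0 ?exprn_ge0// ?(ltW k1_gt0)//.
  rewrite mulrC ler_pdivrMr ?k1_gt0// mulrC.
  exact/kappa_contract/kappa_iter_norm_le1.
exists 0 => _ [L _ <-]; rewrite mulr_ge0//.
  by rewrite invr_ge0 exprn_ge0// ltW ?k1_gt0.
by rewrite subr_ge0; have := kappa_iter_norm_le1 L t1; rewrite ler_norml => /andP[].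
Qed.

Lemma kappa_iter_cvg1 (t : R) : k1 <= 1 -> `|t| <= 1 ->
  (fun L => 1 - kappa_iter J L t) @ \oo --> (0 : R).
Proof.
move=> k11 t1; set u := fun L => _.
have tL L : -1 <= kappa_iter J L t /\ kappa_iter J L t <= 1.
  by have := kappa_iter_norm_le1 L t1; rewrite ler_norml => /andP[].
have u0 L : 0 <= u L by rewrite /u subr_ge0; case: (tL L).
have udec : nonincreasing_seq u.
  apply/nonincreasing_seqP => L.
  apply: le_trans (kappa_contract (kappa_iter_norm_le1 L t1)) _.
  by rewrite ler_piMl// u0.
have uc : cvgn u.
  by apply: nonincreasing_is_cvgn => //; exists 0 => _ [L _ <-].
have ul L : limn u <= u L by exact: nonincreasing_cvgn_ge.
suff -> : 0 = limn u by [].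
have l0 : 0 <= limn u by apply: limr_ge => //; exact: nearW.
apply/eqP; rewrite eq_le l0/= leNgt; apply/negP => lp.
(* If the limit were positive, all iterates would stay below [1 - limn u], where the slopes are at
   most some [q < 1]. Passing to the limit in [u L.+1 <= q * u L] is then contradictory. *)
pose s := Num.max (1 - limn u) 0.
have s1 : s < 1 by rewrite /s gt_max ltr01 andbT; lra.
have s0 : 0 <= s by rewrite /s le_max lexx orbT.
pose q := (1 - kappa J s) / (1 - s).
have q1 : q < 1 by apply: lt_le_trans k11; apply: chord_lt_k1 => //; lra.
have uq L : u L.+1 <= q * u L.
  have [tl _] := tL L; have uL := ul L.
  have tl1 : kappa_iter J L t < 1 by have := uL; rewrite /u; lra.
  have tls : kappa_iter J L t <= 1 - limn u by rewrite lerBrDl -lerBrDr.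
  rewrite -ler_pdivrMr; last by rewrite /u subr_gt0.
  apply: kappa_chord_le => //; rewrite /s le_max; apply/orP; left.
  exact: tls.
have : limn u <= q * limn u.
  have c1 : (fun n => u n.+1) @ \oo --> limn u by have := uc; rewrite -cvg_shiftS.
  have c2 : (fun n => q * u n) @ \oo --> q * limn u by apply: cvgMr.
  by apply: (ler_cvg_to c1 c2); exact: nearW.
by nra.
Qed.

Lemma cvg_power_speed (c rho t : R) : k1 = 1 -> c != 0 -> 1 < rho ->
  (fun t => (1 - kappa J t - k1 * (1 - t) + c * (1 - t) `^ rho)
               / (1 - t) `^ rho) @ 1^'- --> (0 : R) ->
  `|t| <= 1 ->
  cvgn (fun L : nat => (L%:R : R) `^ (rho - 1)^-1 * (1 - kappa_iter J L t)).
Proof.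
move=> k11 c0 rho1 hexp t1.
pose u L := 1 - kappa_iter J L t.
have u0 L : 0 <= u L.
  rewrite /u subr_ge0.
  by have := kappa_iter_norm_le1 L t1; rewrite ler_norml => /andP[].
have ucv : u @ \oo --> (0 : R) by apply: kappa_iter_cvg1 => //; rewrite k11.
(* Once an iterate equals [1] it stays there, and the limit is [0]. Otherwise every [u L] is
   positive and the powers may be divided by. *)
have [[L0 uL0]|nu] := pselect (exists L, u L = 0).
  apply/cvg_ex; exists 0; apply: (@cvg_near_cst _ _ _ _ _ _).
  exists L0 => // L /= L0L; apply/eqP.
  suff : u L = 0 by rewrite /u => ->; rewrite mulr0.
  move: L0L => /subnK <-; elim: (L - L0)%N => // k.
  rewrite addSn /u /kappa_iter/= => /eqP; rewrite subr_eq0 => /eqP <-.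
  by rewrite kappa1 subrr.
have up L : 0 < u L.
  rewrite lt_neqAle u0 andbT; apply/eqP => /esym uL; apply: nu; by exists L.
have uc : (fun n => (u n - u n.+1) / u n `^ (rho - 1 + 1)) @ \oo --> c.
  have tl : (fun L => 1 - u L) @ \oo --> (1 : R)^'-.
    apply: cvg_within_near.
      by rewrite -[X in _ --> X]subr0; apply: cvgB => //; exact: cvg_cst.
    by apply: nearW => n /=; rewrite gtrBl.
  have := cvg_comp _ _ tl hexp.
  move=> /(cvgB (cvg_cst c)); rewrite subr0.
  apply: cvg_trans; apply: near_eq_cvg; apply: nearW => n /=.
  have e : 1 - kappa J (1 - u n) = u n.+1 by rewrite /u subKr.
  change (c - (1 - kappa J (1 - u n) - k1 * (1 - (1 - u n))
    + c * (1 - (1 - u n)) `^ rho) / (1 - (1 - u n)) `^ rho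
    = (u n - u n.+1) / u n `^ (rho - 1 + 1)).
  rewrite e subrK k11 mul1r subKr.
  by field; rewrite gt_eqF// powR_gt0.
(* The sign of [c] follows from [u] being nonincreasing. *)
have cp : 0 < c.
  rewrite lt_neqAle eq_sym c0/=; apply: (cvgr_to_ge uc); apply: nearW => n.
  rewrite divr_ge0 ?powR_ge0// subr_ge0.
  have := kappa_contract (kappa_iter_norm_le1 n t1).
  by rewrite k11 mul1r.
apply/cvg_ex; eexists.
by apply: (@cvg_power_decay _ u (rho - 1) c) => //; rewrite subr_gt0.
Qed.

End Kappa.

(** * Centered normal variables *)

Section Normal.
Context {R : realType}.
Local Notation mu := (@lebesgue_measure R).

(** The Radon-Nikodym derivative of the normal law has the same integrals over measurable sets as
    [normal_pdf], so the two agree almost everywhere. *)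
Lemma integral_normal_prob (m s : R) (f : measurableTypeR R -> \bar R) :
  (forall x, 0 <= f x)%E -> measurable_fun setT f ->
  (\int[normal_prob m s]_x f x = \int[mu]_x (f x * (normal_pdf m s x)%:E))%E.
Proof.
move=> f0 mf.
have dom := @normal_prob_dominates R m s.
rewrite -(Radon_Nikodym_SigmaFinite.change_of_variables dom)//=.
have fi := Radon_Nikodym_SigmaFinite.f_integrable dom.
apply: ae_eq_integral => //=.
- by apply: emeasurable_funM => //; exact: (measurable_int mu).
- apply: emeasurable_funM => //; apply/measurable_EFinP.
  exact: measurable_normal_pdf.
- apply: ae_eqe_mul2l; apply: integral_ae_eq => //=.
  + by apply/measurable_EFinP; exact: measurable_normal_pdf.
  + by move=> E _ mE; rewrite -Radon_Nikodym_SigmaFinite.f_integral.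
Qed.

Lemma normal_mgf (s : R) : s != 0 ->
  (\int[normal_prob 0 s]_x (expR x)%:E = (expR (s ^+ 2 / 2))%:E)%E.
Proof.
move=> s0.
rewrite integral_normal_prob//; last first.
  by apply/measurable_EFinP; exact: measurable_expR.
under eq_integral => x _.
  (* Completing the square turns the exponential weight into a shift of the mean to [s ^+ 2]. *)
  rewrite (_ : _ * _ = (expR (s ^+ 2 / 2))%:E * (normal_pdf (s ^+ 2) s x)%:E)%E;
    last first.
    rewrite !normal_pdfE// -!EFinM; congr (_%:E).
    rewrite mulrCA [RHS]mulrCA; congr (_ * _); rewrite /normal_fun -!expRD.
    by congr expR; field.
  over.
rewrite /= ge0_integralZl//=.
- by rewrite integral_normal_pdf mule1.
- by apply/measurable_EFinP; exact: measurable_normal_pdf.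
- by move=> x _; rewrite lee_fin normal_pdf_ge0.
Qed.

Context dT (T : measurableType dT) (P : probability T R).

Lemma centered_normal_mgf (Z : T -> R) (v : R) : 0 <= v ->
  centered_normal_rv P Z v ->
  (\int[P]_w (expR (Z w))%:E = (expR (v / 2))%:E)%E.
Proof.
move=> v0 [mZ PZ].
pose Y : T -> measurableTypeR R := Z.
have mY : measurable_fun setT Y by [].
have mE : measurable_fun [set: measurableTypeR R] (fun x => (expR x)%:E).
  by apply/measurable_EFinP; exact: measurable_expR.
transitivity (\int[pushforward P Y]_x (expR x)%:E)%E.
  by rewrite ge0_integral_pushforward.
have [v00|vn0] := eqVneq v 0.
  rewrite (eq_measure_integral (\d_(0 : measurableTypeR R))); last first.
    by move=> A mA _; have := PZ A mA; rewrite v00 eqxx.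
  by rewrite integral_dirac//= diracT mul1e v00 mul0r expR0.
rewrite (eq_measure_integral (normal_prob 0 (Num.sqrt v))); last first.
  by move=> A mA _; have := PZ A mA; rewrite (negbTE vn0).
rewrite normal_mgf ?sqr_sqrtr// sqrtr_eq0 -ltNge lt_neqAle eq_sym vn0//.
Qed.

(** A negative [v] would make both [Z] and [- Z] almost surely positive. *)
Lemma centered_normal_variance_ge0 (Z : T -> R) (v : R) :
  centered_normal_rv P Z v -> centered_normal_rv P (fun w => - Z w) v -> 0 <= v.
Proof.
move=> [mZ PZ] [mZN PZN]; rewrite leNgt; apply/negP => v0.
(* For [v < 0] the law is [normal_prob 0 0], the uniform law on [0, 1]. *)
have n0 : normal_prob 0 (Num.sqrt v) `]-oo, (0 : R)] = 0%E.
  rewrite (ler0_sqrtr (ltW v0)) /normal_prob.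
  under eq_integral do rewrite /normal_pdf eqxx.
  rewrite integral_indic//=.
  rewrite (_ : _ `&` _ = [set 0]); first exact: lebesgue_measure_set1.
  apply/seteqP; split=> x /=; rewrite !in_itv/=.
    by case=> /andP[x0 _] x1; apply/eqP; rewrite eq_le x0 x1.
  by move=> ->; rewrite !lexx ler01.
have mI : measurable `]-oo, (0 : R)] by exact: measurable_itv.
have h1 : P (Z @^-1` `]-oo, (0 : R)]) = 0%E by rewrite PZ// lt_eqF// n0.
have h2 : P ((fun w => - Z w) @^-1` `]-oo, (0 : R)]) = 0%E.
  by rewrite PZN// lt_eqF// n0.
have : (P [set: T] <= P (Z @^-1` `]-oo, 0%R]) +
    P ((fun w => - Z w)%R @^-1` `]-oo, 0%R]))%E.
  rewrite (_ : [set: T] = Z @^-1` `]-oo, 0] `|`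
    (fun w => - Z w) @^-1` `]-oo, 0]).
    apply: measureU2; rewrite -[X in measurable X]setTI;
    [exact: mZ|exact: mZN].
  apply/seteqP; split=> x //= _; rewrite !in_itv/= oppr_le0.
  by case: (leP (Z x) 0) => [|/ltW]; [left|right].
by rewrite h1 h2 adde0 probability_setT lee_fin ler10.
Qed.

End Normal.

(** * Quadratic rate functions *)

Section Dot.
Context {R : realType} {m : nat}.
Implicit Types x y z th : 'rV[R]_m.

Lemma dotvE x y : dotv x y = \sum_i x 0 i * y 0 i.
Proof. by rewrite /dotv mxE; apply: eq_bigr => i _; rewrite mxE. Qed.

Lemma dotvC x y : dotv x y = dotv y x.
Proof. by rewrite !dotvE; apply: eq_bigr => i _; rewrite mulrC. Qed.

Lemma dotvDl x y z : dotv (x + y) z = dotv x z + dotv y z.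
Proof. by rewrite /dotv mulmxDl mxE. Qed.

Lemma dotvZl (c : R) x y : dotv (c *: x) y = c * dotv x y.
Proof. by rewrite /dotv -scalemxAl mxE. Qed.

Lemma dotvDr x y z : dotv x (y + z) = dotv x y + dotv x z.
Proof. by rewrite dotvC dotvDl !(dotvC x). Qed.

Lemma dotvZr (c : R) x y : dotv x (c *: y) = c * dotv x y.
Proof. by rewrite dotvC dotvZl dotvC. Qed.

Lemma dotv0l x : dotv 0 x = 0.
Proof. by rewrite /dotv mul0mx mxE. Qed.

Lemma dotv_delta (i : 'I_m) x : dotv (delta_mx 0 i) x = x 0 i.
Proof.
rewrite dotvE (bigD1 i)//= big1 ?addr0 ?mxE ?eqxx ?mul1r// => j ji.
by rewrite mxE (negbTE ji) andbF mul0r.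
Qed.

Lemma dotv_continuous th : continuous (dotv th).
Proof.
rewrite (_ : dotv th = (fun x => \sum_i th 0 i * x 0 i)); last first.
  by apply/funext => x; rewrite dotvE.
apply: continuous_big => [|i _ z]; first exact: add_continuous.
exact: (cvgM (cvg_cst _) (@coord_continuous _ _ _ 0 i z)).
Qed.

Lemma open_gt_dotv th (a : R) : open [set z | a < dotv th z].
Proof.
rewrite (_ : [set z | _] = dotv th @^-1` [set x | a < x])//.
by apply: open_comp => [z _|]; [exact: dotv_continuous|exact: open_gt].
Qed.

Lemma closed_ge_dotv th (a : R) : closed [set z | a <= dotv th z].
Proof.
rewrite (_ : [set z | _] = dotv th @^-1` [set x | a <= x])//.
by apply: closed_comp => [z _|]; [exact: dotv_continuous|exact: closed_ge].
Qed.

Lemma closed_box_compact (A : set 'rV[R]_m) (M : R) : closed A ->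
  (forall y, A y -> forall i, `|y 0 i| <= M) -> compact A.
Proof.
move=> cA AM.
have cb : compact [set v : 'rV[R]_m | forall i, v ord0 i \in `[- M, M]].
  apply: (@rV_compact _ _ (fun=> `[- M, M]%classic)).
  by move=> _; exact: segment_compact.
apply: (subclosed_compact cA cb) => y /AM yM i.
by rewrite in_itv/= -ler_norml.
Qed.

Lemma open_box y (e : R) : open [set z : 'rV[R]_m | forall i, `|z 0 i - y 0 i| < e].
Proof.
rewrite (_ : [set z | _] = \big[setI/setT]_(i < m)
  ([set z | y 0 i - e < dotv (delta_mx 0 i) z] `&`
   [set z | - y 0 i - e < dotv (-1 *: delta_mx 0 i) z])).
  apply: big_ind => [|A B|i _]; [exact: openT|exact: openI|].
  by apply: openI; exact: open_gt_dotv.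
apply/seteqP; split => z /=; rewrite -bigcap_seq/=.
  move=> h i _ /=; have := h i; rewrite dotvZl dotv_delta.
  by rewrite ltr_norml => /andP[]; lra.
move=> h i; have [] := h i (mem_index_enum i); rewrite /= dotvZl dotv_delta => h1 h2.
by rewrite ltr_norml; apply/andP; lra.
Qed.

Lemma closed_box y (e : R) :
  closed [set z : 'rV[R]_m | forall i, `|z 0 i - y 0 i| <= e].
Proof.
rewrite (_ : [set z | _] = \bigcap_i
  ([set z | y 0 i - e <= dotv (delta_mx 0 i) z] `&`
   [set z | - y 0 i - e <= dotv (-1 *: delta_mx 0 i) z])).
  by apply: closed_bigI => i _; apply: closedI; exact: closed_ge_dotv.
apply/seteqP; split => z /= h i.
  move=> _ /=; have := h i; rewrite dotvZl dotv_delta.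
  by rewrite ler_norml => /andP[]; lra.
have [] := h i I; rewrite /= dotvZl dotv_delta => h1 h2.
by rewrite ler_norml; apply/andP; lra.
Qed.

(** For a covariance matrix [B], the log-moment generating function of the centered Gaussian
    vector. *)
Definition half_form (B : 'M[R]_m) th : R := 2^-1 * (th *m B *m th^T) 0 0.

Lemma half_form_shift (B : 'M[R]_m) th i (c : R) : B^T = B ->
  half_form B (th + c *: delta_mx 0 i) =
  half_form B th + c * (th *m B) 0 i + c ^+ 2 * B i i / 2.
Proof.
move=> sB; rewrite /half_form -!/(dotv (_ *m B) _).
set e := delta_mx 0 i.
have h1 : dotv (th *m B) e = (th *m B) 0 i by rewrite dotvC dotv_delta.
have h2 : dotv (e *m B) th = (th *m B) 0 i.
  rewrite -h1 /dotv; transitivity ((e *m B *m th^T)^T 0 0).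
    by rewrite [RHS]mxE.
  by rewrite !trmx_mul trmxK sB mulmxA.
have h3 : dotv (e *m B) e = B i i.
  by rewrite dotvC dotv_delta /e -rowE mxE.
rewrite mulmxDl -scalemxAl !(dotvDl, dotvDr, dotvZl, dotvZr) h1 h2 h3.
by field.
Qed.

End Dot.

Section RateFunction.
Context {R : realType} {m : nat}.
Variable B : 'M[R]_m.
Implicit Types y th : 'rV[R]_m.

(** The Legendre transform of [half_form B]; at [Bmat g xs] it unfolds to [rate_I g xs]. *)
Definition quad_rate y : \bar R :=
  ereal_sup (range (fun th : 'rV[R]_m => (dotv th y - half_form B th)%:E)).

Lemma quad_rate_ge th y : ((dotv th y - half_form B th)%:E <= quad_rate y)%E.
Proof. by apply: ereal_sup_ubound; exists th. Qed.

Lemma quad_rate_gt (a : R) y : (a%:E < quad_rate y)%E ->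
  exists th, a + half_form B th < dotv th y.
Proof.
move=> /ereal_sup_gt[_ [th _ <-]]; rewrite lte_fin => h; exists th; lra.
Qed.

Lemma half_form0 : half_form B 0 = 0.
Proof. by rewrite /half_form !mul0mx mxE mulr0. Qed.

(** A supremum of continuous affine functions is lower semicontinuous. Testing it at plus and minus
    the unit vectors bounds every coordinate on a sublevel set. *)
Lemma good_quad_rate : B^T = B -> good_rate_function quad_rate.
Proof.
move=> sB.
have lsc : lower_semicontinuous quad_rate.
  move=> y a /quad_rate_gt[th ath].
  exists [set z | a + half_form B th < dotv th z].
    by apply: open_nbhs_nbhs; split => //; exact: open_gt_dotv.
  move=> z /= h; apply: lt_le_trans (quad_rate_ge th z); rewrite lte_fin; lra.
split; [|split => //].
  move=> y; apply: le_trans (quad_rate_ge 0 y).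
  by rewrite dotv0l half_form0 subr0.
move=> a.
apply: (@closed_box_compact _ _ _ (a + \sum_i `|B i i|)).
  rewrite (_ : [set y | _] = ~` [set y | (a%:E < quad_rate y)%E]).
    by apply: open_closedC; move/lower_semicontinuousP : lsc; exact.
  by apply/seteqP; split => y /=; rewrite leNgt => /negP.
move=> y /= Iy i.
have Bi : B i i / 2 <= \sum_i `|B i i|.
  apply: (@le_trans _ _ `|B i i|).
    by have := ler_norm (B i i); have := normr_ge0 (B i i); lra.
  by rewrite (bigD1 i)//= lerDl sumr_ge0.
have key (c : R) : c ^+ 2 = 1 -> c * y 0 i <= a + B i i / 2.
  move=> c1; have := le_trans (quad_rate_ge (c *: delta_mx 0 i) y) Iy.
  rewrite lee_fin dotvZl dotv_delta -[c *: _]add0r half_form_shift//.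
  by rewrite half_form0 mul0mx mxE c1; lra.
have := key 1 (expr1n _ _); have := key (-1) (sqrr_sign _ 1%N).
by rewrite ler_norml => h1 h2; apply/andP; lra.
Qed.

Lemma quad_rate_pinfty y : ~~ (y <= B)%MS -> quad_rate y = +oo%E.
Proof.
rewrite submxE => /rV0Pn[j yj]; set K := cokermx B in yj.
(* Columns of the cokernel are killed by [B]. Along multiples of [th] the quadratic term vanishes
   while the linear term is unbounded. *)
pose th := (col j K)^T.
have Bth : B *m th^T = 0.
  by rewrite trmxK colE mulmxA mulmx_coker mul0mx.
have hth c : half_form B (c *: th) = 0.
  rewrite /half_form [(c *: th)^T]linearZ/= -mulmxA -scalemxAr Bth.
  by rewrite scaler0 mulmx0 mxE mulr0.
have yth : dotv th y = (y *m K) 0 j.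
  by rewrite dotvC /dotv trmxK colE mulmxA -colE mxE.
apply/eqyP => A A0; apply: le_trans (quad_rate_ge ((A / (y *m K) 0 j) *: th) y).
by rewrite hth subr0 dotvZl yth divfK.
Qed.

End RateFunction.

(** * Measurability, logarithms and limits *)

Section MeasurableRow.
Context {R : realType} {m : nat} {d : measure_display} {T : measurableType d}.
Variable f : T -> 'rV[R]_m.
Hypothesis mf : forall i, measurable_fun setT (fun w => f w 0 i).

Lemma measurable_box (c : 'rV[R]_m) (e : R) :
  measurable [set w | forall i, `|f w 0 i - c 0 i| < e].
Proof.
rewrite (_ : [set w | _] =
    \big[setI/setT]_(i < m) [set w | `|f w 0 i - c 0 i| < e]); last first.
  apply/seteqP; split => w /=; rewrite -bigcap_seq/= => h i; last first.
    exact: (h i (mem_index_enum i)).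
  by move=> _; exact: h.
apply: bigsetI_measurable => i _.
rewrite (_ : [set w | _] = (fun w => `|f w 0 i - c 0 i|) @^-1` `]-oo, e[).
  rewrite -[X in measurable X]setTI.
  have mg : measurable_fun setT (fun w => `|f w 0 i - c 0 i|).
    by apply: measurableT_comp => //; apply: measurable_funB.
  by apply: mg => //; exact: measurable_itv.
by apply/seteqP; split => w /=; rewrite in_itv.
Qed.

(** Only the coordinates of [f] are known to be measurable, so [O] is written as a countable union
    of boxes with rational centers and radii [1 / (n + 1)]. *)
Lemma measurable_preimage_open (O : set 'rV[R]_m) : open O ->
  measurable (f @^-1` O).
Proof.
move=> oO.
pose c (p : 'rV[rat]_m * nat) : 'rV[R]_m := \row_i ratr (p.1 0 i).
pose e (p : 'rV[rat]_m * nat) : R := p.2.+1%:R^-1.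
pose F p := if `[< [set z : 'rV[R]_m | forall i, `|z 0 i - c p 0 i| < e p] `<=` O >]
  then [set w | forall i, `|f w 0 i - c p 0 i| < e p] else set0.
rewrite (_ : f @^-1` O = \bigcup_p F p).
  apply: countable_bigcupT_measurable; first exact: countableP.
  by move=> p; rewrite /F; case: ifP => // _; exact: measurable_box.
apply/seteqP; split => w /=; last first.
  by move=> [p _]; rewrite /F; case: asboolP => // sub /sub.
move=> Ow.
have : nbhs (f w) O by exact: open_nbhs_nbhs.
move=> /nbhs_ballP[r /= r0 rO].
have [n _ nr] := near_infty_natSinv_lt (PosNum (divr_gt0 r0 (ltr0n R 2))).
(* With radius below [r / 2], a box that contains [f w] lies in the ball of radius [r] around it. *)
have [x [xE x0 xr]] : exists x : R, [/\ x = n.+1%:R^-1, 0 < x & x < r / 2].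
  by exists n.+1%:R^-1; split => //; exact: (nr n (leqnn n)).
have /choice[q hq] : forall i, exists q : rat, `|f w 0 i - ratr q| < x.
  move=> i; have [|q] := @rat_in_itvoo R (f w 0 i - x) (f w 0 i + x); first lra.
  rewrite in_itv/= => /andP[q1 q2]; exists q.
  by rewrite ltr_norml; apply/andP; lra.
exists (\row_i q i, n) => //; rewrite /F /c /e/= -xE.
case: asboolP => [_ i|]; first by rewrite !mxE.
case=> z /= hz; apply: rO; split => // a b.
rewrite (ord1 a) /ball/=.
have := hz b; have := hq b; rewrite !mxE /= => h1 h2.
have -> : f w 0 b - z 0 b = (f w 0 b - ratr (q b)) - (z 0 b - ratr (q b)).
  by ring.
by apply: le_lt_trans (ler_normB _ _) _; lra.
Qed.

Lemma measurable_preimage_closed (C : set 'rV[R]_m) : closed C ->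
  measurable (f @^-1` C).
Proof.
move=> cC; rewrite -[C]setCK preimage_setC; apply: measurableC.
by apply: (@measurable_preimage_open (~` C)); exact: closed_openC.
Qed.

Lemma measurable_dotv th : measurable_fun setT (fun w => dotv th (f w)).
Proof.
under eq_fun do rewrite dotvE.
by apply: measurable_sum => i; apply: measurable_funM.
Qed.

End MeasurableRow.

(** The sign hypothesis excludes [-oo], which [elog] sends to [+oo]. *)
Lemma elog_le {R : realType} (p : \bar R) (r : R) :
  (0 <= p)%E -> (p <= (expR r)%:E)%E -> (elog p <= r%:E)%E.
Proof.
case: p => [p| |]//=; rewrite ?lee_fin => p0 pr.
case: ifPn => [pp|_]; last exact: leNye.
by rewrite lee_fin -(expRK r) ler_ln ?posrE// expR_gt0.
Qed.

Lemma elog_ge {R : realType} (p : \bar R) (r : R) :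
  ((expR r)%:E <= p)%E -> (r%:E <= elog p)%E.
Proof.
case: p => [p| |]//=; rewrite ?lee_fin => pr.
  have pp : 0 < p by apply: lt_le_trans pr; exact: expR_gt0.
  by rewrite pp lee_fin -[leLHS](expRK r) ler_ln ?posrE// expR_gt0.
exact: leey.
Qed.

Lemma limn_esup_le_near {R : realType} (u : (\bar R)^nat) (x : \bar R) :
  (\forall n \near \oo, u n <= x)%E -> (limn_esup u <= x)%E.
Proof.
move=> ux; rewrite /limn_esup /limf_esup.
apply: le_trans (ereal_inf_lbound _) _; first by exists [set n | (u n <= x)%E].
by apply: ge_ereal_sup => _ [n /= h <-].
Qed.

Lemma limn_einf_ge_near {R : realType} (u : (\bar R)^nat) (x : \bar R) :
  (\forall n \near \oo, x <= u n)%E -> (x <= limn_einf u)%E.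
Proof.
move=> ux; rewrite /limn_einf leeNr; apply: limn_esup_le_near.
by apply: filterS ux => n; rewrite /= leeN2.
Qed.

Lemma lee_real_below {R : realType} (x y : \bar R) :
  (forall b : R, (b%:E < x)%E -> (b%:E <= y)%E) -> (x <= y)%E.
Proof.
case: x => [r| |] h; last exact: leNye.
- apply/lee_subgt0Pr => e e0; rewrite -EFinB; apply: h.
  by rewrite lte_fin gtrBl.
- by rewrite leye_eq; apply/eqP/eqyP => A _; apply: h; rewrite ltry.
Qed.

(** * Large deviations from quadratic log-moment generating functions *)

Section QuadraticLDP.
Context {R : realType} {m : nat} {dO : nat -> measure_display}.
Variables (Om : forall L, measurableType (dO L)).
Variables (P : forall L, probability (Om L) R) (X : forall L, Om L -> 'rV[R]_m).
Variables (v : nat -> R) (Lam : nat -> 'rV[R]_m -> R) (B : 'M[R]_m).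
Arguments X : clear implicits.
Hypothesis mX : forall L, (1 <= L)%N ->
  forall i, measurable_fun setT (fun w => X L w 0 i).
Hypothesis v_pinfty : v @ \oo --> +oo.
Hypothesis mgf : forall L, (1 <= L)%N -> forall th,
  (\int[P L]_w (expR (v L * dotv th (X L w)))%:E = (expR (v L * Lam L th))%:E)%E.
Hypothesis Lam_cvg : forall th, (Lam ^~ th) @ \oo --> half_form B th.
Arguments Lam_cvg : clear implicits.
Hypothesis symB : B^T = B.
Implicit Types (th eta y : 'rV[R]_m) (a b : R).

Let v_gt0 : \forall L \near \oo, 0 < v L.
Proof. by move/cvgryPgt : v_pinfty; exact. Qed.

Let L_ge1 : \forall L \near \oo, (1 <= L)%N.
Proof. by exists 1%N. Qed.

Let expR_v_ge (c e : R) : 0 < e -> \forall L \near \oo, c <= expR (v L * e).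
Proof.
move=> e0; have : \forall L \near \oo, c / e <= v L.
  by move/cvgryPge : v_pinfty; exact.
apply: filterS => L; rewrite ler_pdivrMr// => h.
by apply: le_trans (expR_ge1Dx _); lra.
Qed.

(** The exponentially tilted measure, left unnormalised: its total mass is the moment generating
    function, and [th = 0] gives back the law of [X L]. *)
Definition tilted L th (A : set 'rV[R]_m) : \bar R :=
  (\int[P L]_(w in X L @^-1` A) (expR (v L * dotv th (X L w)))%:E)%E.

(** Exponential decay at rate at least [a]. Asking for the bound at each [b < a] leaves room for
    constant factors and for the error in [Lam_cvg], which makes the notion stable under finite
    unions. *)
Definition tilted_rate th (A : set 'rV[R]_m) (a : R) : Prop :=
  (forall L, (1 <= L)%N -> measurable (X L @^-1` A)) /\
  forall b, b < a ->
    \forall L \near \oo, (tilted L th A <= (expR (- (v L * b)))%:E)%E.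

Let mexp L (th : 'rV[R]_m) D : (1 <= L)%N ->
  measurable_fun D (fun w => (expR (v L * dotv th (X L w)))%:E).
Proof.
move=> L1; apply/measurable_funTS/measurable_EFinP.
apply: measurableT_comp => //; apply: measurable_funM => //.
exact/measurable_dotv/mX.
Qed.

Lemma tilted0 L A : (1 <= L)%N -> measurable (X L @^-1` A) ->
  tilted L 0 A = P L (X L @^-1` A).
Proof.
move=> L1 mA; rewrite /tilted.
under eq_integral do rewrite dotv0l mulr0 expR0.
by rewrite integral_cst// mul1e.
Qed.

Lemma tiltedT L th : (1 <= L)%N -> tilted L th setT = (expR (v L * Lam L th))%:E.
Proof. by move=> L1; rewrite /tilted preimage_setT mgf. Qed.

Lemma le_tilted L th A C : (1 <= L)%N ->
  measurable (X L @^-1` A) -> measurable (X L @^-1` C) -> A `<=` C ->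
  (tilted L th A <= tilted L th C)%E.
Proof.
move=> L1 mA mC AC; apply: ge0_subset_integral => //.
- exact: mexp.
- by move=> w /= /AC.
Qed.

Lemma tiltedU L th A C : (1 <= L)%N ->
  measurable (X L @^-1` A) -> measurable (X L @^-1` C) ->
  (tilted L th (A `|` C) <= tilted L th A + tilted L th C)%E.
Proof.
move=> L1 mA mC; pose D := (X L @^-1` C) `\` (X L @^-1` A).
have mD : measurable D by exact: measurableD.
have e : X L @^-1` (A `|` C) = (X L @^-1` A) `|` D.
  apply/seteqP; split => w /=; last by case=> [|[]]; [left|right].
  by have [Aw|nAw] := pselect (A (X L w)); [left|case=> // Cw; right].
rewrite /tilted e ge0_integral_setU//.
- apply: leeD => //; apply: ge0_subset_integral => //; first exact: mexp.
  by move=> w [].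
- exact: mexp.
- by apply/eqP; rewrite setDIK.
Qed.

(** On the half-space the factor [exp (v L * (dotv eta z - b))] is at least [1]; inserting it
    changes the tilt to [th + eta]. *)
Lemma tilted_chernoff L th eta (b : R) : (1 <= L)%N -> 0 < v L ->
  (tilted L th [set z | (b <= dotv eta z)%R]
    <= (expR (v L * (Lam L (th + eta) - b)))%:E)%E.
Proof.
move=> L1 v0; set A := [set z | _].
have mA : measurable (X L @^-1` A).
  by apply: (measurable_preimage_closed (mX L1)); exact: closed_ge_dotv.
apply: (@le_trans _ _ (\int[P L]_(w in X L @^-1` A)
   ((expR (- (v L * b)))%:E * (expR (v L * dotv (th + eta) (X L w)))%:E))%E).
  apply: ge0_le_integral => //.
  - exact: mexp.
  - by apply: emeasurable_funM; [exact: measurable_cst|exact: mexp].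
  - move=> w /= Aw; rewrite -EFinM lee_fin -expRD ler_expR dotvDl.
    by have := ler_wpM2l (ltW v0) Aw; lra.
rewrite ge0_integralZl//; last exact: mexp.
rewrite (_ : v L * (_ - b) = - (v L * b) + v L * Lam L (th + eta)); last by ring.
rewrite expRD EFinM lee_wpmul2l// -tiltedT//.
by apply: le_tilted => //; rewrite preimage_setT; exact: measurableT.
Qed.

Lemma tilted_rateS th A C a : tilted_rate th C a -> A `<=` C ->
  (forall L, (1 <= L)%N -> measurable (X L @^-1` A)) -> tilted_rate th A a.
Proof.
move=> [mC hC] AC mA; split => // b ba; have := hC b ba.
move: L_ge1; apply: filterS2 => L L1; apply: le_trans.
by apply: le_tilted => //; [exact: mA|exact: mC].
Qed.

Lemma tilted_rate_half_space th eta b a :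
  a <= b - half_form B (th + eta) -> tilted_rate th [set z | b <= dotv eta z] a.
Proof.
move=> ab; split => [L L1|b' b'a].
  by apply: (measurable_preimage_closed (mX L1)); exact: closed_ge_dotv.
near=> L.
have L1 : (1 <= L)%N by near: L.
have v0 : 0 < v L by near: L.
apply: le_trans (tilted_chernoff _ _ _ L1 v0) _.
rewrite lee_fin ler_expR -mulrN ler_pM2l// lerBlDr.
apply: ltW; near: L.
by apply: (cvgr_lt _ (Lam_cvg (th + eta))); lra.
Unshelve. all: by end_near. Qed.

Lemma tilted_rate0 th a : tilted_rate th set0 a.
Proof.
split => [L _|b _]; first by rewrite preimage_set0; exact: measurable0.
apply: nearW => L; rewrite /tilted preimage_set0 integral_set0 lee_fin.
exact: expR_ge0.
Qed.

Lemma tilted_rateU th A C a :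
  tilted_rate th A a -> tilted_rate th C a -> tilted_rate th (A `|` C) a.
Proof.
move=> [mA hA] [mC hC]; split => [L L1|b ba].
  by rewrite preimage_setU; apply: measurableU; [exact: mA|exact: mC].
(* The gap between [b] and [b'] absorbs the factor [2] coming from the two sets. *)
pose b' := (a + b) / 2.
have b'a : b' < a by rewrite /b'; lra.
near=> L.
have L1 : (1 <= L)%N by near: L.
have hAL : (tilted L th A <= (expR (- (v L * b')))%:E)%E by near: L; exact: hA.
have hCL : (tilted L th C <= (expR (- (v L * b')))%:E)%E by near: L; exact: hC.
have h2 : 2 <= expR (v L * (b' - b)).
  by near: L; apply: expR_v_ge; rewrite /b'; lra.
apply: le_trans (tiltedU _ L1 (mA L L1) (mC L L1)) _.
apply: le_trans (leeD hAL hCL) _.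
rewrite -EFinD lee_fin.
have -> : - (v L * b) = v L * (b' - b) + - (v L * b') by ring.
rewrite expRD; have := ler_wpM2r (expR_ge0 (- (v L * b'))) h2; lra.
Unshelve. all: by end_near. Qed.

Lemma tilted_rate_big (I : Type) (r : seq I) (Q : pred I) (F : I -> set 'rV[R]_m)
    th a : (forall i, Q i -> tilted_rate th (F i) a) ->
  tilted_rate th (\big[setU/set0]_(i <- r | Q i) F i) a.
Proof.
move=> h; apply: (big_ind (fun A => tilted_rate th A a)) => //.
- exact: tilted_rate0.
- by move=> A C; exact: tilted_rateU.
Qed.

Let box y (e : R) := [set z : 'rV[R]_m | forall i, `|z 0 i - y 0 i| < e].

Let mbox y e L : (1 <= L)%N -> measurable (X L @^-1` box y e).
Proof.
by move=> L1; apply: (measurable_preimage_open (mX L1)); exact: open_box.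
Qed.

Let mboxC y e L : (1 <= L)%N -> measurable (X L @^-1` ~` box y e).
Proof. by move=> L1; rewrite -preimage_setC; apply/measurableC/mbox. Qed.

(** The complement of the box is covered by two half-spaces per coordinate. The scale [lam] of their
    normals is free: [1] serves the upper bound, a small value the lower bound. *)
Lemma tilted_rate_boxC th y (e lam a : R) :
  (forall i c, c \in [:: lam; - lam] ->
    a <= lam * e + c * y 0 i - half_form B (th + c *: delta_mx 0 i)) ->
  0 < lam -> tilted_rate th (~` box y e) a.
Proof.
move=> ha l0.
pose H i c := [set z | lam * e + c * y 0 i <= dotv (c *: delta_mx 0 i) z].
apply: (@tilted_rateS _ _ (\big[setU/set0]_(i < m) (H i lam `|` H i (- lam)))).
- apply: tilted_rate_big => i _; apply: tilted_rateU;
    by apply: tilted_rate_half_space; apply: ha; rewrite !inE eqxx ?orbT.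
- move=> z /= /existsNP[i /negP]; rewrite -leNgt => ei.
  rewrite -bigcup_seq; exists i; first exact: mem_index_enum.
  rewrite /H /= !dotvZl dotv_delta.
  have [s|s] := leP 0 (z 0 i - y 0 i).
    left; have := ei; rewrite ger0_norm// => /(ler_wpM2l (ltW l0)); lra.
  right; have := ei; rewrite ltr0_norm// => /(ler_wpM2l (ltW l0)); lra.
- exact: mboxC.
Qed.

Let diag_le (i : 'I_m) : B i i <= \sum_i `|B i i|.
Proof. by rewrite (bigD1 i)//= ler_wpDr ?ler_norm// sumr_ge0. Qed.

Lemma tilted_rate_closed (C : set 'rV[R]_m) a : closed C ->
  (forall y, C y -> (a%:E < quad_rate B y)%E) -> tilted_rate 0 C a.
Proof.
(* With this [M], the half-spaces outside the box have rate [M - B i i / 2], which is at least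
   [a]. *)
move=> cC aC; pose M := a + \sum_i `|B i i|.
pose U th := [set z | a + half_form B th < dotv th z].
pose K := C `&` [set z | forall i, `|z 0 i - (0 : 'rV[R]_m) 0 i| <= M].
have cK : compact K.
  apply: (@closed_box_compact _ _ _ M).
    by apply: closedI => //; exact: closed_box.
  by move=> y [_ +] i => /(_ i); rewrite mxE subr0.
have UK : K `<=` cover setT U.
  by move=> y [/aC/quad_rate_gt[th ?] _]; exists th.
have oU th : setT th -> open (U th) by move=> _; exact: open_gt_dotv.
(* Each point of [K] has rate above [a], hence lies in an open half-space of rate [a]; finitely many
   of these suffice. *)
move: cK; rewrite compact_cover => /(_ _ setT U oU UK)[D' _ KD].
apply: (@tilted_rateS _ _ ((\big[setU/set0]_(th <- finmap.enum_fset D') U th) `|` ~` box 0 M)).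
- apply: tilted_rateU.
    apply: tilted_rate_big => th _.
    apply: (@tilted_rateS _ _ [set z | a + half_form B th <= dotv th z]).
    + by apply: tilted_rate_half_space; rewrite add0r; lra.
    + by move=> z /ltW.
    + move=> L L1; apply: (measurable_preimage_open (mX L1)).
      exact: open_gt_dotv.
  apply: (@tilted_rate_boxC _ _ _ 1) => // i c.
  rewrite !inE => cE; have c1 : c ^+ 2 = 1.
    by case/orP: cE => /eqP ->; rewrite ?sqrrN expr1n.
  rewrite half_form_shift// half_form0 mul0mx !mxE c1 /M.
  have := diag_le i; have : 0 <= \sum_i `|B i i| by rewrite sumr_ge0.
  by lra.
- move=> y Cy; have [yb|yb] := pselect (box 0 M y); [left|by right].
  have : K y by split => // i; exact/ltW/yb.
  by move=> /KD[th thD Uy]; rewrite -bigcup_seq; exists th.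
- by move=> L L1; exact: (measurable_preimage_closed (mX L1)).
Qed.

Lemma quadratic_ldp_upper (C : set 'rV[R]_m) : closed C ->
  (limn_esup (fun L => ((v L)^-1)%:E * elog (P L (X L @^-1` C)))
     <= - ereal_inf (quad_rate B @` C))%E.
Proof.
move=> cC; rewrite leeNr; apply: lee_real_below => a aC.
have [mC hC] : tilted_rate 0 C a.
  apply: tilted_rate_closed => // y Cy; apply: lt_le_trans aC _.
  by apply: ereal_inf_lbound; exists y.
apply: lee_real_below => b; rewrite lte_fin => /hC hb.
rewrite leeNr; apply: limn_esup_le_near.
near=> L.
have L1 : (1 <= L)%N by near: L.
have v0 : 0 < v L by near: L.
rewrite lee_pdivrMl//; apply: elog_le => //.
rewrite -tilted0//; last exact: mC.
by rewrite mulrN; near: L.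
Unshelve. all: by end_near. Qed.

Lemma tilted_le_box L th y (e c : R) : (1 <= L)%N -> 0 < v L ->
  (forall z, box y e z -> dotv th z <= c) ->
  (tilted L th (box y e) <= (expR (v L * c))%:E * P L (X L @^-1` box y e))%E.
Proof.
move=> L1 v0 hc; rewrite -integral_cst; last exact: mbox.
apply: ge0_le_integral => //; [exact: mbox|exact: mexp|].
by move=> w /= /hc h; rewrite lee_fin ler_expR ler_pM2l.
Qed.

(** The tilted measure has mass about [exp (v L * q)], concentrated near [y]. There its density is
    about [exp (v L * 2 q)], so the probability is about [exp (- v L * q)]. *)
Lemma quadratic_lower_point th (O : set 'rV[R]_m) (r : R) :
  open O -> O (th *m B) -> r < - half_form B th ->
  \forall L \near \oo, ((expR (v L * r))%:E <= P L (X L @^-1` O))%E.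
Proof.
move=> oO Oy rq; set y := th *m B in Oy; set q := half_form B th in rq.
have yq : dotv th y = 2 * q.
  by rewrite dotvC /q /half_form -/(dotv y th); field.
(* A quarter of the slack: one [dl] pays for the variation of the density on the box, the rest for
   the loss [g1] and the factor [2]. *)
pose dl := (- q - r) / 4.
have dl0 : 0 < dl by rewrite /dl; lra.
pose N1 := 1 + \sum_i `|th 0 i|.
have N10 : 0 < N1 by rewrite /N1 ltr_pwDl// sumr_ge0.
have [e [e0 eO eN]] : exists e, [/\ 0 < e, box y e `<=` O & e * N1 <= dl].
  have : nbhs y O by exact: open_nbhs_nbhs.
  move=> /nbhs_ballP[r0 /= r00 rO].
  exists (Num.min r0 (dl / N1)); split.
  - by rewrite lt_min r00 divr_gt0.
  - move=> z hz; apply: rO; split => // i j; rewrite (ord1 i).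
    have := hz j; rewrite lt_min => /andP[+ _].
    by rewrite distrC.
  - by rewrite -ler_pdivlMr// ge_min lexx orbT.
have hdot z : box y e z -> dotv th z <= 2 * q + dl.
  move=> hz; rewrite -yq -lerBlDl; apply: le_trans eN.
  rewrite !dotvE -sumrB; apply: le_trans (ler_norm _) _.
  apply: le_trans (ler_norm_sum _ _ _) _.
  apply: (@le_trans _ _ (\sum_i e * `|th 0 i|)).
    apply: ler_sum => i _; rewrite -mulrBr normrM mulrC.
    by rewrite ler_wpM2r// ltW.
  by rewrite -mulr_sumr ler_wpM2l ?ltW// /N1; lra.
(* In the Chernoff exponent the terms linear in [lam] leave [lam * e], since [y = th *m B] is the
   gradient of [half_form B] at [th]. This [lam] keeps the quadratic term below half of it, so the
   exterior gains [2 * ga]. *)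
pose lam := e / (1 + \sum_i `|B i i|).
have SB : 0 < 1 + \sum_i `|B i i| by rewrite ltr_pwDl// sumr_ge0.
have lam0 : 0 < lam by rewrite /lam divr_gt0.
have lamE : lam * (1 + \sum_i `|B i i|) = e by rewrite /lam divfK// gt_eqF.
pose ga := lam * e / 4.
have le0 : 0 < lam * e by rewrite mulr_gt0.
have ga0 : 0 < ga by rewrite /ga; lra.
have [mWC hWC] : tilted_rate th (~` box y e) (2 * ga - q).
  apply: (@tilted_rate_boxC _ _ _ lam) => // i c.
  rewrite !inE => cE; have c1 : c ^+ 2 = lam ^+ 2.
    by case/orP: cE => /eqP ->; rewrite ?sqrrN.
  rewrite half_form_shift// -/y -/q c1.
  suff : lam ^+ 2 * B i i / 2 <= lam * e / 2 by rewrite /ga; lra.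
  rewrite ler_pM2r// expr2 -mulrA ler_pM2l// -lamE ler_pM2l//.
  by have := diag_le i; lra.
(* The loss allowed for the total mass: below [ga], so that the exterior is eventually at most half
   of it, and below [3 * dl], for the final comparison. *)
pose g1 := Num.min ga dl / 2.
have g1a : 0 < ga - g1.
  have : Num.min ga dl <= ga by rewrite ge_min lexx.
  by rewrite /g1; lra.
have g1d : g1 <= dl / 2.
  have : Num.min ga dl <= dl by rewrite ge_min lexx orbT.
  by rewrite /g1; lra.
have g10 : 0 < g1 by rewrite /g1 divr_gt0// lt_min ga0.
near=> L.
have L1 : (1 <= L)%N by near: L.
have v0 : 0 < v L by near: L.
have tWC : (tilted L th (~` box y e) <= (expR (v L * (q - ga)))%:E)%E.
  rewrite -opprB mulrN; near: L; apply: hWC; lra.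
have tT : ((expR (v L * (q - g1)))%:E <= tilted L th setT)%E.
  rewrite tiltedT// lee_fin ler_expR ler_pM2l//; apply: ltW; near: L.
  by apply: (cvgr_gt _ (Lam_cvg th)); rewrite -/q; lra.
have h1 : 2 <= expR (v L * (ga - g1)) by near: L; exact: expR_v_ge.
have h2 : 2 <= expR (v L * (3 * dl - g1)) by near: L; apply: expR_v_ge; lra.
pose G := expR (v L * (q - g1)).
have G0 : 0 < G by exact: expR_gt0.
have tW : ((G / 2)%:E <= tilted L th (box y e))%E.
  have TU : (tilted L th setT <=
      tilted L th (box y e) + tilted L th (~` box y e))%E.
    by rewrite -(setUv (box y e)); apply: tiltedU => //; [exact: mbox|exact: mboxC].
  have half : expR (v L * (q - ga)) <= G / 2.
    rewrite ler_pdivlMr// /G.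
    have -> : v L * (q - g1) = v L * (q - ga) + v L * (ga - g1) by ring.
    by rewrite expRD ler_wpM2l ?expR_ge0.
  have -> : (G / 2)%:E = (G%:E - (G / 2)%:E)%E by rewrite -EFinB; congr EFin; lra.
  rewrite leeBlDr//; apply: le_trans tT _; apply: le_trans TU _.
  by rewrite leeD2l//; apply: le_trans tWC _; rewrite lee_fin.
have PW : ((expR (v L * r))%:E <= P L (X L @^-1` box y e))%E.
  have c0 : 0 < expR (v L * (2 * q + dl)) by exact: expR_gt0.
  rewrite -(@lee_pmul2l _ (expR (v L * (2 * q + dl)))%:E) ?lte_fin//.
  apply: le_trans (tilted_le_box L1 v0 hdot); apply: le_trans tW.
  rewrite -EFinM lee_fin -expRD ler_pdivlMr// /G.
  have -> : v L * (q - g1) = (v L * (2 * q + dl) + v L * r) + v L * (3 * dl - g1).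
    by rewrite /dl; field.
  by rewrite [leRHS]expRD ler_wpM2l ?expR_ge0.
apply: le_trans PW _; apply: le_measure; rewrite ?inE.
- exact: mbox.
- exact: (measurable_preimage_open (mX L1)).
- by move=> w /eO.
Unshelve. all: by end_near. Qed.

Lemma quadratic_ldp_lower (O : set 'rV[R]_m) : open O ->
  (- ereal_inf (quad_rate B @` O)
     <= limn_einf (fun L => ((v L)^-1)%:E * elog (P L (X L @^-1` O))))%E.
Proof.
move=> oO; rewrite leeNl; apply: le_ereal_inf_tmp => _ [y Oy <-].
rewrite leeNl.
have [/submxP[th yE]|yB] := boolP (y <= B)%MS; last first.
  by rewrite quad_rate_pinfty// leNye.
rewrite {y}yE in Oy *.
(* At [th *m B], the supremum tested at [th] gives a rate of at least [half_form B th]. *)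
apply: (@le_trans _ _ (- half_form B th)%:E).
  rewrite EFinN leeN2; apply: le_trans (quad_rate_ge _ th _).
  rewrite lee_fin dotvC /half_form -/(dotv (th *m B) th).
  by lra.
apply: lee_real_below => r; rewrite lte_fin => rq.
apply: limn_einf_ge_near; near=> L.
have v0 : 0 < v L by near: L.
rewrite lee_pdivlMl//; apply: elog_ge; near: L.
exact: quadratic_lower_point oO Oy rq.
Unshelve. all: by end_near. Qed.

Lemma quadratic_LDP : LDP P X v (quad_rate B).
Proof.
by split; [exact: quadratic_ldp_upper|exact: quadratic_ldp_lower].
Qed.

End QuadraticLDP.

(** * Increments of the Gaussian field *)

Section GaussianField.
Context {R : realType}.

(** Both [x + y] and [x - y] have nonnegative squared norm. *)
Lemma sphere_dotv_le1 (n : nat) (x y : 'rV[R]_n.+1) :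
  sphere x -> sphere y -> `|dotv x y| <= 1.
Proof.
move=> sx sy.
have key (c : R) : c ^+ 2 = 1 -> 0 <= 2 + 2 * c * dotv x y.
  move=> c1; have : 0 <= dotv (x + c *: y) (x + c *: y).
    by rewrite dotvE sumr_ge0// => i _; rewrite -expr2 sqr_ge0.
  rewrite !(dotvDl, dotvDr, dotvZl, dotvZr) (dotvC y x) sx sy mulr1.
  by rewrite -expr2 c1; lra.
have := key 1 (expr1n _ _); have := key (-1) (sqrr_sign _ 1%N).
by rewrite ler_norml => h1 h2; apply/andP; lra.
Qed.

Lemma sphere_north_pole (d : nat) : sphere (north_pole d : 'rV[R]_d.+1).
Proof.
rewrite /sphere dotvE (bigD1 ord_max)//= big1 => [|i /negbTE ni].
  by rewrite mxE eqxx mulr1 addr0.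
by rewrite mxE ni mul0r.
Qed.

Lemma half_form_cvg (m : nat) (M : nat -> 'M[R]_m) (B : 'M[R]_m) th :
  (forall i j, (fun L => M L i j) @ \oo --> B i j) ->
  (fun L => half_form (M L) th) @ \oo --> half_form B th.
Proof.
move=> h.
have e (A : 'M[R]_m) : half_form A th =
    2^-1 * \sum_j (\sum_i th 0 i * A i j) * th 0 j.
  rewrite /half_form mxE; congr (_ * _); apply: eq_bigr => j _.
  by rewrite !mxE.
under eq_fun do rewrite e.
rewrite e; apply: (cvgM (cvg_cst _)).
apply: cvg_big => [|j _]; first exact: add_continuous.
apply: cvgM; last exact: cvg_cst.
apply: cvg_big => [|i _]; first exact: add_continuous.
exact: (cvgM (cvg_cst _) (h i j)).
Qed.

Lemma Bmat_sym (d m : nat) (g : R -> R) (xs : 'I_m -> 'rV[R]_d.+1) :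
  (Bmat g xs)^T = Bmat g xs.
Proof.
apply/matrixP => i j; rewrite !mxE (dotvC (xs j) (xs i)).
by rewrite [g _ + g _]addrC.
Qed.

Variables (d m : nat) (dT : measure_display) (T : measurableType dT).
Variables (P : probability T R) (F : 'rV[R]_d.+1 -> T -> R) (k : R -> R).
Variable xs : 'I_m -> 'rV[R]_d.+1.
Hypothesis gF : centered_gaussian_field P F (fun x y => k (dotv x y)).
Hypothesis sxs : forall i, sphere (xs i).
Hypothesis k1 : k 1 = 1.

Let X w := \row_(i < m) (F (xs i) w - F (north_pole d) w).

Lemma increment_normal (th : 'rV[R]_m) :
  centered_normal_rv P (fun w => dotv th (X w))
    (2 * half_form (Bmat (fun t => 1 - k t) xs) th).
Proof.
(* The field hypothesis is applied to [m + m] points: the [xs i] with weights [th 0 i] and [m]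
   copies of the pole with the opposite weights. *)
pose pt (s : 'I_m + 'I_m) := if s is inl i then xs i else north_pole d.
pose wt (s : 'I_m + 'I_m) := match s with inl i => th 0 i | inr i => - th 0 i end.
have sp (i : 'I_(m + m)) : sphere (pt (fintype.split i)).
  by case: (fintype.split i) => j /=; [exact: sxs|exact: sphere_north_pole].
have := gF (fun i => wt (fintype.split i)) sp.
set Z := (fun w => _); set V := \sum_(i < m + m) _.
suff [-> ->] : Z = (fun w => dotv th (X w)) /\
    V = 2 * half_form (Bmat (fun t => 1 - k t) xs) th by [].
have sl (i : 'I_m) : fintype.split (lshift m i) = inl i by exact: (unsplitK (inl i)).
have sr (i : 'I_m) : fintype.split (rshift m i) = inr i by exact: (unsplitK (inr i)).
split.
  apply/funext => w; rewrite /Z big_split_ord/= dotvE -big_split/=.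
  by apply: eq_bigr => i _; rewrite !mxE sl sr /=; ring.
rewrite /V big_split_ord/= -big_split/=.
rewrite /half_form mulrA divff// mul1r mxE.
under [RHS]eq_bigr do rewrite mxE mulr_suml.
rewrite exchange_big/=; apply: eq_bigr => i _.
rewrite !big_split_ord/= -!big_split/=; apply: eq_bigr => j _.
rewrite !sl !sr /= !mxE (sphere_north_pole d) k1 (dotvC (north_pole d)).
by ring.
Qed.

(** The form is even in [th], so a linear combination and its opposite are normal with the same
    variance parameter. *)
Lemma increment_variance_ge0 th : 0 <= half_form (Bmat (fun t => 1 - k t) xs) th.
Proof.
have h1 := increment_normal th; have := increment_normal (-1 *: th).
set a := half_form _ th in h1 *.
have -> : half_form (Bmat (fun t => 1 - k t) xs) (-1 *: th) = a.
  by rewrite /a /half_form [(-1 *: th)^T]linearZ/= -!scalemxAl -scalemxAr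
    scalerA mulrNN mulr1 scale1r.
under eq_fun do rewrite dotvZl mulN1r.
by move=> h2; have := centered_normal_variance_ge0 h1 h2; lra.
Qed.

Lemma increment_mgf (c : R) (th : 'rV[R]_m) :
  (\int[P]_w (expR (c * dotv th (X w)))%:E =
   (expR (c * (c * half_form (Bmat (fun t => 1 - k t) xs) th)))%:E)%E.
Proof.
have h := increment_normal (c *: th).
have e : half_form (Bmat (fun t => 1 - k t) xs) (c *: th)
       = c * (c * half_form (Bmat (fun t => 1 - k t) xs) th).
  rewrite /half_form [(c *: th)^T]linearZ/= -!scalemxAl -scalemxAr.
  by rewrite !mxE; ring.
have h0 : 0 <= 2 * half_form (Bmat (fun t => 1 - k t) xs) (c *: th).
  by rewrite mulr_ge0// increment_variance_ge0.
under eq_integral do rewrite -dotvZl.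
rewrite (centered_normal_mgf h0 h) e; congr (expR _)%:E.
by field.
Qed.

End GaussianField.

(** * Divergence of the speeds and the two regimes *)

Lemma powR_cvg_pinfty {R : realType} (p : R) : 0 < p ->
  (fun L : nat => (L%:R : R) `^ p) @ \oo --> +oo.
Proof.
move=> p0; apply/cvgryPge => A.
pose A1 := Num.max A 1.
have A10 : 0 < A1 by rewrite /A1 lt_max ltr01 orbT.
near=> L.
apply: (@le_trans _ _ A1); first by rewrite /A1 le_max lexx.
have -> : A1 = (A1 `^ p^-1) `^ p.
  by rewrite -powRrM mulVf ?gt_eqF// powRr1// ltW.
apply: ge0_ler_powR; rewrite ?nnegrE ?powR_ge0// ?ltW//.
near: L; exact: nbhs_infty_gtr.
Unshelve. all: by end_near. Qed.

Lemma expV_cvg_pinfty {R : realType} (k : R) : 0 < k -> k < 1 ->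
  (fun L : nat => k ^- L) @ \oo --> +oo.
Proof.
move=> k0 k1; apply/gtr0_cvgV0.
  by apply: nearW => L; rewrite invr_gt0 exprn_gt0.
suff h : (fun L : nat => (k ^- L)^-1) @ \oo --> (0 : R) by exact: h.
under eq_fun do rewrite invrK.
by apply: cvg_expr; rewrite ger0_norm ?ltW.
Qed.

(** Common to both regimes, which enter only through the divergence of [v] and the convergence of
    [v L * (1 - kappa_iter J L t)]. *)
Lemma field_increment_LDP (R : realType) (d : nat) (J : nat -> R)
  (dO : nat -> measure_display) (Om : forall L, measurableType (dO L))
  (P : forall L, probability (Om L) R)
  (T : forall L, 'rV[R]_d.+1 -> Om L -> R)
  (m : nat) (xs : 'I_m -> 'rV[R]_d.+1) (v : nat -> R) :
  series (fun q : nat => J q ^+ 2 / (q`!)%:R) @ \oo --> (1 : R) ->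
  (forall L, (1 <= L)%N ->
     centered_gaussian_field (P L) (T L)
       (fun x y => kappa_iter J L (dotv x y)) /\
     (forall x, measurable_fun setT (T L x))) ->
  (forall i, sphere (xs i)) ->
  v @ \oo --> +oo ->
  (forall t, `|t| <= 1 -> cvgn (fun L => v L * (1 - kappa_iter J L t))) ->
  let X := fun L (w : Om L) =>
    \row_(i < m) (T L (xs i) w - T L (north_pole d) w) in
  let g := fun t : R => limn (fun L : nat => v L * (1 - kappa_iter J L t)) in
  good_rate_function (rate_I g xs) /\ LDP P X v (rate_I g xs).
Proof.
move=> hJ hT sxs v_oo hcv X g.
split; first exact: (good_quad_rate (Bmat_sym g xs)).
apply: (@quadratic_LDP _ _ _ _ P X v
  (fun L th => v L * half_form (Bmat (fun t => 1 - kappa_iter J L t) xs) th)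
  (Bmat g xs)) => //.
- move=> L L1 i; rewrite /X; under eq_fun do rewrite mxE.
  by have [_ mT] := hT L L1; apply: measurable_funB.
- move=> L L1 th; have [gT _] := hT L L1.
  by apply: increment_mgf => //; exact: kappa_iter1.
- move=> th.
  (* Moving the speed inside the form reduces the limit to convergence of the matrix entries. *)
  have e L : v L * half_form (Bmat (fun t => 1 - kappa_iter J L t) xs) th =
      half_form (v L *: Bmat (fun t => 1 - kappa_iter J L t) xs) th.
    by rewrite /half_form -scalemxAr -scalemxAl [in RHS]mxE; ring.
  under eq_fun do rewrite e.
  apply: half_form_cvg => i j; rewrite mxE.
  under eq_fun do rewrite !mxE mulrBr mulrDr.
  apply: cvgB; first apply: cvgD.
  + by apply: hcv; apply: sphere_dotv_le1 => //; exact: sphere_north_pole.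
  + by apply: hcv; apply: sphere_dotv_le1 => //; exact: sphere_north_pole.
  + by apply: hcv; apply: sphere_dotv_le1.
- exact: Bmat_sym.
Qed.

Theorem theorem3p3 (R : realType) (d : nat) (J : nat -> R)
  (dO : nat -> measure_display) (Om : forall L, measurableType (dO L))
  (P : forall L, probability (Om L) R)
  (T : forall L, 'rV[R]_d.+1 -> Om L -> R)
  (m : nat) (xs : 'I_m -> 'rV[R]_d.+1) (k1 : R) :
  (1 <= d)%N ->
  (forall n : nat, exists q : nat, (n <= q)%N /\ J q != 0) ->
  cvgn (series (fun q : nat => `|J q.+1| / (q`!)%:R)) ->
  series (fun q : nat => J q ^+ 2 / (q`!)%:R) @ \oo --> (1 : R) ->
  (forall L, (1 <= L)%N ->
     centered_gaussian_field (P L) (T L)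
       (fun x y => kappa_iter J L (dotv x y)) /\
     (forall x, measurable_fun setT (T L x)) /\
     as_continuous_field (P L) (T L)) ->
  (1 <= m)%N ->
  (forall i, sphere (xs i)) ->
  injective xs ->
  (* k1 = kappa'(1), the (left) derivative of kappa at 1 *)
  (fun t => (kappa J 1 - kappa J t) / (1 - t)) @ 1^'- --> k1 ->
  k1 <= 1 ->
  let X := fun L (w : Om L) =>
    \row_(i < m) (T L (xs i) w - T L (north_pole d) w) in
  (k1 < 1 ->
     let v := fun L : nat => k1 ^- L in
     let g := fun t : R => limn (fun L : nat => v L * (1 - kappa_iter J L t)) in
     good_rate_function (rate_I g xs) /\ LDP P X v (rate_I g xs)) /\
  (forall (c rho : R), k1 = 1 -> c != 0 -> 1 < rho ->
     (fun t => (1 - kappa J t - k1 * (1 - t) + c * (1 - t) `^ rho)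
               / (1 - t) `^ rho) @ 1^'- --> (0 : R) ->
     let v := fun L : nat => (L%:R : R) `^ (rho - 1)^-1 in
     let g := fun t : R => limn (fun L : nat => v L * (1 - kappa_iter J L t)) in
     good_rate_function (rate_I g xs) /\ LDP P X v (rate_I g xs)).
Proof.
move=> _ hJinf _ hJ hT _ sxs _ hk1 k1_le1 X.
have hT' L : (1 <= L)%N ->
    centered_gaussian_field (P L) (T L) (fun x y => kappa_iter J L (dotv x y)) /\
    (forall x, measurable_fun setT (T L x)).
  by move=> /hT[? []].
split=> [k1_lt1 v g|c rho k1E c0 rho1 hexp v g].
  apply: field_increment_LDP => //.
    exact: expV_cvg_pinfty (k1_gt0 hJ hJinf hk1) k1_lt1.
  by move=> t t1; exact: (cvg_geometric_speed hJ hJinf hk1).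
apply: field_increment_LDP => //.
  by apply: powR_cvg_pinfty; rewrite invr_gt0 subr_gt0.
by move=> t t1; exact: (cvg_power_speed hJ hJinf hk1 k1E c0 rho1 hexp t1).
Qed.
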